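(* For every formula $\phi$ of the logic $\mathrm{S1S}+\forall^{\ast}$ one can effectively construct an $\mathrm{S1S}$ formula $\psi$ that is semantically equivalent to $\phi$ (i.e. defines the same language).
   Context: $\mathrm{S1S}$ is monadic second-order logic over the structure $(\omega,<)$: formulas are built from atoms $x<y$ and $x\in X$ using $\neg$, $\vee$, first-order quantification $\forall x$ over natural numbers and second-order quantification $\forall X$ over subsets of $\omega$. Subsets of $\omega$ are identified with their characteristic $\omega$-words in $\{0,1\}^\omega$; a formula $\phi(X_1,\dots,X_n)$ whose free variables are the second-order variables $X_1,\dots,X_n$ defines the language $L(\phi)\subseteq (\{0,1\}^n)^\omega$ of tuples satisfying it (free first-order variables can be simulated by second-order variables constrained to be singletons). Two formulas are semantically equivalent if they define the same language. The logic $\mathrm{S1S}+\forall^{\ast}$ extends the syntax of $\mathrm{S1S}$ with a second-order quantifier $\forall^{\ast}X.\,\phi$, whose semantics is: a tuple $w\in(\{0,1\}^n)^\omega$ satisfies $\forall^{\ast}X.\,\phi(X,Y_1,\dots,Y_n)$ iff the set $\{w'\in\{0,1\}^\omega \mid (w',w)\text{ satisfies }\phi\}$ is comeager in the Cantor space $\{0,1\}^\omega$ (with the product topology). *)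

(* Defs.v *)
From HB Require Import structures.
From Stdlib Require Cantor.
From mathcomp Require Import all_boot all_classical all_reals all_analysis.

Set Implicit Arguments.
Unset Strict Implicit.
Unset Printing Implicit Defensive.

Local Open Scope classical_set_scope.

Definition nowhere_dense (T : topologicalType) (A : set T) : Prop :=
  interior (closure A) = set0.

Definition meager (T : topologicalType) (A : set T) : Prop :=
  exists2 F : nat -> set T,
    (forall i, nowhere_dense (F i)) & A = \bigcup_i F i.

Definition comeager (T : topologicalType) (A : set T) : Prop :=
  meager (~` A).

(** First-order and second-order variables are two disjoint copies of [nat]:
  the number [3] names both the individual variable x_3 and the set variable
  X_3. *)

Inductive formula : Type :=
| Less    of nat & nat        (* x < y *)
| Elem    of nat & nat        (* x \in X *)
| Neg     of formula
| Or      of formula & formula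
| AllFO   of nat & formula    (* forall x, phi *)
| AllSO   of nat & formula    (* forall X, phi *)
| AllStar of nat & formula.   (* forall* X, phi *)

Fixpoint isS1S (phi : formula) : bool :=
  match phi with
  | Less _ _ | Elem _ _ => true
  | Neg p | AllFO _ p | AllSO _ p => isS1S p
  | Or p q => isS1S p && isS1S q
  | AllStar _ _ => false
  end.

Fixpoint freeFO (phi : formula) : seq nat :=
  match phi with
  | Less x y => [:: x; y]
  | Elem x _ => [:: x]
  | Neg p | AllSO _ p | AllStar _ p => freeFO p
  | Or p q => freeFO p ++ freeFO q
  | AllFO x p => [seq y <- freeFO p | y != x]
  end.

Fixpoint freeSO (phi : formula) : seq nat :=
  match phi with
  | Less _ _ => [::]
  | Elem _ X => [:: X]
  | Neg p | AllFO _ p => freeSO p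
  | Or p q => freeSO p ++ freeSO q
  | AllSO X p | AllStar X p => [seq Y <- freeSO p | Y != X]
  end.

(** [in_context m n phi]: the free variables of [phi] are among the
  individual variables x_0, ..., x_(m-1) and the set variables
  X_0, ..., X_(n-1). *)
Definition in_context (m n : nat) (phi : formula) : bool :=
  all (fun x => x < m) (freeFO phi) && all (fun X => X < n) (freeSO phi).

Definition update (A : Type) (f : nat -> A) (x : nat) (a : A) : nat -> A :=
  fun y => if y == x then a else f y.

(** A subset of omega is its characteristic word in [cantor_space], which
  unfolds to [nat -> bool]. *)
Fixpoint sat (phi : formula) (nu : nat -> nat) (mu : nat -> cantor_space)
    : Prop :=
  match phi with
  | Less x y => nu x < nu y
  | Elem x X => mu X (nu x)
  | Neg p => ~ sat p nu mu
  | Or p q => sat p nu mu \/ sat q nu mu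
  | AllFO x p => forall k : nat, sat p (update nu x k) mu
  | AllSO X p => forall w : cantor_space, sat p nu (update mu X w)
  | AllStar X p =>
      comeager [set w : cantor_space | sat p nu (update mu X w)]
  end.

Definition track (k : nat) (w : nat -> k.-tuple bool) (i : nat)
    : cantor_space :=
  fun t => nth false (w t) i.

(** The omega-language over {0,1}^(m+n) of a formula in context [m n]: the
  first [m] tracks hold the individual variables, each simulated by a
  singleton set, and the last [n] tracks hold the set variables. In a context
  with m = 0 this is the usual language of phi(X_0, ..., X_(n-1)) over
  {0,1}^n. The values of [nu] outside the first [m] variables, and of the
  set valuation outside the first [n], are irrelevant to a formula in
  context. *)
Definition language (m n : nat) (phi : formula)
    : set (nat -> (m + n).-tuple bool) :=
  [set w | exists2 nu : nat -> nat,
      (forall i, i < m -> track w i = (fun t => t == nu i)) &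
      sat phi nu (fun X => track w (m + X))].

Arguments language : clear implicits.

(** Kleene's mu-recursive functions, indexed by arity. *)
Inductive mu_rec : nat -> Type :=
| RZero n : mu_rec n
| RSucc : mu_rec 1
| RProj n : 'I_n -> mu_rec n
| RComp k n : mu_rec k -> ('I_k -> mu_rec n) -> mu_rec n
| RPrec n : mu_rec n -> mu_rec n.+2 -> mu_rec n.+1
| RMin n : mu_rec n.+1 -> mu_rec n.

(** [computes f x v]: the partial function [f] is defined at [x] with value
  [v]. In the case of primitive recursion, [h i] is the value at [(i, x)]. *)
Fixpoint computes (n : nat) (f : mu_rec n) : n.-tuple nat -> nat -> Prop :=
  match f in mu_rec n return n.-tuple nat -> nat -> Prop with
  | RZero n => fun _ v => v = 0
  | RSucc => fun x v => v = (thead x).+1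
  | RProj n i => fun x v => v = tnth x i
  | RComp k n f g => fun x v =>
      exists2 y : k.-tuple nat,
        (forall j, computes (g j) x (tnth y j)) & computes f y v
  | RPrec n f g => fun x v =>
      exists h : nat -> nat,
        [/\ computes f [tuple of behead x] (h 0),
            (forall i, i < thead x ->
               computes g [tuple of i :: h i :: behead x] (h i.+1)) &
            v = h (thead x)]
  | RMin n f => fun x v =>
      computes f [tuple of v :: x] 0 /\
      (forall i, i < v -> exists u, computes f [tuple of i :: x] u.+1)
  end.

(** Goedel numbering by the Cantor pairing function. *)
Definition pair_code (a b : nat) : nat := Cantor.to_nat (a, b).

Fixpoint code (phi : formula) : nat :=
  match phi with
  | Less x y    => pair_code 0 (pair_code x y)
  | Elem x X    => pair_code 1 (pair_code x X)
  | Neg p       => pair_code 2 (code p)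
  | Or p q      => pair_code 3 (pair_code (code p) (code q))
  | AllFO x p   => pair_code 4 (pair_code x (code p))
  | AllSO X p   => pair_code 5 (pair_code X (code p))
  | AllStar X p => pair_code 6 (pair_code X (code p))
  end.

Lemma pair_code_inj a b c d :
  pair_code a b = pair_code c d -> a = c /\ b = d.
Proof.
by move=> /(congr1 Cantor.of_nat); rewrite !Cantor.cancel_of_to => -[].
Qed.

Lemma code_inj : injective code.
Proof.
elim=> [x y|x X|p IHp|p IHp q IHq|x p IHp|X p IHp|X p IHp]
  [x' y'|x' X'|p'|p' q'|x' p'|X' p'|X' p'] /pair_code_inj[] // _.
- by case/pair_code_inj=> -> ->.
- by case/pair_code_inj=> -> ->.
- by move/IHp=> ->.
- by case/pair_code_inj=> /IHp-> /IHq->.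
- by case/pair_code_inj=> -> /IHp->.
- by case/pair_code_inj=> -> /IHp->.
- by case/pair_code_inj=> -> /IHp->.
Qed.

Definition effective (tr : formula -> formula) : Prop :=
  exists f : mu_rec 1, forall phi, computes f [tuple code phi] (code (tr phi)).

(* Main.v *)
Require Import Defs.
From mathcomp Require Import all_boot all_classical all_reals all_analysis.
From mathcomp Require Import zify.

(** The quantifier [forall*] is definable in S1S by one uniform template. A set
  of words is comeager iff it contains, for some infinite [P] and some word
  [Z], every word that agrees with [Z] on infinitely many intervals [[a, b)]
  with end points in [P]: if the complement is a union of nowhere dense sets
  F_0, F_1, ..., one builds [P] and [Z] block by block so that agreeing with
  [Z] on the block starting at [n] excludes F_0, ..., F_n, whatever the first
  [n] letters are. The right-hand side quantifies only over [P], [Z] and words,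
  so [forall* X, phi] becomes [exists P Z, ...] with [phi] used as a black box
  and without automata. *)

Set Implicit Arguments.
Unset Strict Implicit.
Unset Printing Implicit Defensive.

Local Open Scope classical_set_scope.

(** * Comeager subsets of the Cantor space *)

Definition cylinder (n : nat) (x : cantor_space) : set cantor_space :=
  [set y | forall i, i < n -> y i = x i].

Lemma cylinder_nbhs n x : nbhs x (cylinder n x).
Proof.
elim: n => [|n IHn]; first by apply: filterS filterT => y _ i.
have nx : nbhs x [set y : cantor_space | y n = x n].
  apply: (@proj_continuous _ (fun _ : nat => bool) n x [set x n]).
  by apply: open_nbhs_nbhs; split=> //; exact: discrete_open.
apply: filterS2 IHn nx => y yx ynx i; rewrite ltnS leq_eqVlt.
by case/predU1P=> [->|/yx].
Qed.

(** The filter generated by the cylinders around [x] converges to [x] in each coordinate, hence in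
    the product topology, so it contains every neighbourhood of [x]. *)
Lemma nbhs_cylinder x A : nbhs x A -> exists n, cylinder n x `<=` A.
Proof.
pose F := filter_from [set: nat] (cylinder^~ x).
have FF : Filter F.
  apply: filter_from_filter; first by exists 0.
  move=> m n _ _; exists (maxn m n) => // y yx.
  by split=> i lti; apply: yx; rewrite leq_max lti ?orbT.
have Fx : {ptws, F --> x}.
  apply/pointwise_cvgP => i B /nbhs_singleton Bx.
  by exists i.+1 => // y /(_ i (ltnSn i)) /= ->.
by move=> /Fx [n _ nA]; exists n.
Qed.

Lemma nowhere_denseP (F : set cantor_space) :
  nowhere_dense F <->
  forall x n, exists y m, cylinder n x y /\ cylinder m y `<=` ~` F.
Proof.
split=> [F0 x n|Favoid].
  have /existsNP[y /not_implyP[xy Fy]] : ~ (cylinder n x `<=` closure F).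
    move=> sub; suff : interior (closure F) x by rewrite F0.
    exact: filterS sub (cylinder_nbhs n x).
  have : nbhs y (~` F).
    by rewrite -[~ closure F y]/((~` closure F) y) -interiorC in Fy.
  by case/nbhs_cylinder=> m ym; exists y, m.
rewrite /nowhere_dense -subset0 => x /nbhs_cylinder[n xF].
have [y [m [/xF Fy ymF]]] := Favoid x n.
by have [z [Fz /ymF]] := Fy _ (cylinder_nbhs m y).
Qed.

Definition splice (n : nat) (x y : cantor_space) : cantor_space :=
  fun i => if i < n then x i else y i.

(** The pairs in [L] are treated one after another. For a new pair [(s, i)], nowhere density is
    applied to [s] followed by the block built so far; the block only grows, so the pairs already
    treated stay excluded. *)
Lemma avoid_all (F : nat -> set cantor_space) (n : nat)
    (L : seq (n.-tuple bool * nat)) :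
    (forall i, nowhere_dense (F i)) ->
  exists m z, n < m /\ forall s i, (s, i) \in L ->
    forall y : cantor_space, (forall j, j < n -> y j = nth false s j) ->
    (forall j, n <= j < m -> y j = z j) -> ~ F i y.
Proof.
move=> F0; elim: L => [|[s i] L [m [z [ltnm IHL]]]].
  by exists n.+1, (fun=> false).
have [y [p [yz yF]]] :=
  (nowhere_denseP (F i)).1 (F0 i) (splice n (nth false s) z) m.
(* The cylinder length [p] may be below [m]; the maximum keeps the old block as well. *)
exists (maxn m p), y; split=> [|t k]; first by rewrite leq_max ltnm.
rewrite inE => /predU1P[[-> ->]|tkL] w ws wy.
  apply: yF => j ltjp; case: (ltnP j n) => [ltjn|lenj].
    by rewrite ws // yz ?(ltn_trans ltjn) // /splice ltjn.
  by rewrite wy // lenj leq_max ltjp orbT.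
apply: (IHL _ _ tkL) => // j /andP[lenj ltjm].
by rewrite wy ?leq_max ?lenj ?ltjm // yz // /splice ltnNge lenj.
Qed.

(** Only finitely many pairs of a prefix of length [n] and an index up to [n] exist, so a single
    block handles them all. *)
Lemma avoid_block (F : nat -> set cantor_space) (n : nat) :
    (forall i, nowhere_dense (F i)) ->
  exists mz : nat * cantor_space, n < mz.1 /\ forall i y, i <= n ->
    (forall j, n <= j < mz.1 -> y j = mz.2 j) -> ~ F i y.
Proof.
move=> F0.
pose L := [seq (s, i) | s <- enum {: n.-tuple bool}, i <- iota 0 n.+1].
have [m [z [ltnm mzF]]] := avoid_all L F0.
exists (m, z); split=> // i y lein yz.
apply: (mzF [tuple of mkseq y n] i) => //; last by move=> j ltjn; rewrite nth_mkseq.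
by apply/allpairsP; exists ([tuple of mkseq y n], i); rewrite mem_enum mem_iota.
Qed.

(** * Partition of the naturals into blocks *)

Section Blocks.
Variables (f : nat -> nat) (ltf : forall n, n < f n).

(** The last of the block boundaries 0, [f 0], [f (f 0)], ... below or at [i]. *)
Fixpoint block_start (i : nat) : nat :=
  if i is j.+1 then
    if f (block_start j) == i then i else block_start j
  else 0.

Lemma block_start_bounds i : block_start i <= i < f (block_start i).
Proof.
elim: i => [|i /andP[le_i lt_i]] /=; first exact: ltf.
by case: eqVneq => [_|nei]; rewrite ?leqnn ?ltf // leqW //= ltn_neqAle eq_sym nei.
Qed.

Lemma block_start_id i : block_start (block_start i) = block_start i.
Proof. by elim: i => //= i IHi; case: ifP => //= ->. Qed.

Lemma block_start_const a j :
  block_start a = a -> a <= j < f a -> block_start j = a.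
Proof.
move=> aP /andP[+ ltj]; elim: j ltj => [|j IHj] ltj; rewrite leq_eqVlt.
  by case/predU1P=> [<-|].
case/predU1P=> [<- //|leaj] /=.
by rewrite IHj ?(ltnW ltj) // gtn_eqF.
Qed.

Lemma block_start_next n : block_start (f (block_start n)) = f (block_start n).
Proof.
have /andP[le_n lt_n] := block_start_bounds n.
(* The predecessor [c] of the next boundary still lies in the current block, so at [c.+1] the
   recursion compares with exactly this boundary. *)
case E: (f _) (lt_n) => [//|c] lenc /=.
rewrite (@block_start_const (block_start n) c) ?block_start_id ?E ?eqxx //.
by rewrite ltnSn (leq_trans le_n).
Qed.

Lemma block_end_le a b :
  block_start a = a -> block_start b = b -> a < b -> f a <= b.
Proof.
move=> aP bP ltab; rewrite leqNgt; apply/negP => ltbf.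
have := block_start_const aP (introT andP (conj (ltnW ltab) ltbf)).
by rewrite bP => eqba; rewrite eqba ltnn in ltab.
Qed.

End Blocks.

Definition unbounded (P : cantor_space) := forall n, exists m, n < m /\ P m.

(** [a] and [b] need not be consecutive in [P]: agreement on [[a, b)] implies
  agreement on the first block of [P] inside it. *)
Definition matches (P Z w : cantor_space) := forall n, exists a b,
  [/\ n < a < b, P a, P b & forall i, a <= i < b -> w i = Z i].

Lemma comeager_matches (A : set cantor_space) : comeager A ->
  exists P Z, unbounded P /\ forall w, matches P Z w -> A w.
Proof.
case=> F F0 AF.
have /choice[mz mzP] : forall n, exists mz : nat * cantor_space,
    n < mz.1 /\ forall i y, i <= n ->
    (forall j, n <= j < mz.1 -> y j = mz.2 j) -> ~ F i y.
  by move=> n; exact: avoid_block.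
pose f n := (mz n).1; have ltf n : n < f n by have [] := mzP n.
(* [P] is the set of block boundaries, and [Z] concatenates the words chosen for the blocks. *)
exists (fun a => block_start f a == a), (fun i => (mz (block_start f i)).2 i).
split=> [n|w wP].
  exists (f (block_start f n)); rewrite block_start_next // eqxx; split=> //.
  by have /andP[] := block_start_bounds ltf n.
apply: contrapT => nAw; have : (~` A) w by [].
rewrite AF => -[i _ Fiw].
(* An agreement interval beyond the index [i] contains the whole block starting at [a], and that
   block excludes [F i] because [i < a]. *)
have [a [b [/andP[ltia ltab] /eqP aP /eqP bP wZ]]] := wP i.
have [_ /(_ i w (ltnW ltia))] := mzP a; apply=> // j /[dup] ajf /andP[leaj ltjf].
rewrite wZ ?leaj ?(leq_trans ltjf (block_end_le aP bP ltab)) //.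
by rewrite (block_start_const aP ajf).
Qed.

(** The words without an agreement interval beyond [n] form a nowhere dense set: any prefix can be
    continued up to a late point [a] of [P] and then by a copy of [Z] up to a further point [b]. *)
Lemma matches_comeager (A : set cantor_space) (P Z : cantor_space) :
  unbounded P -> (forall w, matches P Z w -> A w) -> comeager A.
Proof.
move=> Pinf PZA.
pose miss n := [set w : cantor_space | forall a b, n < a < b -> P a -> P b ->
  ~ forall i, a <= i < b -> w i = Z i].
(* [meager] demands equality with the union, so each [miss n] is cut down to the complement of
   [A]. *)
exists (fun n => ~` A `&` miss n) => [n|]; last first.
  rewrite -setI_bigcupr; apply/esym/setIidPl => w Aw.
  have /existsNP[n wn] : ~ matches P Z w by move=> /PZA.
  by exists n => // a b ltab Pa Pb wZ; apply: wn; exists a, b.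
apply/nowhere_denseP => x k.
have [a [lta Pa]] := Pinf (maxn n k); have [b [ltab Pb]] := Pinf a.
move: lta; rewrite gtn_max => /andP[ltna ltka].
exists (splice a x Z), b; split=> [i ltik|w wb [_ /(_ a b)]].
  by rewrite /splice (ltn_trans ltik).
rewrite ltna ltab; apply=> // i /andP[leai ltib].
by rewrite wb // /splice ltnNge leai.
Qed.

(** * The definable quantifier *)

Lemma leq_pair_code a b : a + b <= pair_code a b.
Proof. by have := Cantor.to_nat_non_decreasing a b; rewrite /pair_code; lia. Qed.

Lemma ltn_pair_code a b : b < pair_code a.+1 b.
Proof. by have := leq_pair_code a.+1 b; lia. Qed.

Lemma freeSO_code p v : v \in freeSO p -> v <= Defs.code p.
Proof.
have le2 a b c : c <= b -> c <= pair_code a b.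
  by have := leq_pair_code a b; lia.
have le1 a b c : c <= a -> c <= pair_code a b.
  by have := leq_pair_code a b; lia.
elim: p => //= [x X|p IHp|p IHp q IHq|x p IHp|X p IHp|X p IHp].
- by rewrite inE => /eqP->; apply/le2/le2.
- by move=> /IHp; apply: le2.
- by rewrite mem_cat => /orP[/IHp|/IHq] le; apply: (le2); [apply: le1|apply: le2].
- by move=> /IHp le; apply/le2/le2.
- by rewrite mem_filter => /andP[_ /IHp le]; apply/le2/le2.
- by rewrite mem_filter => /andP[_ /IHp le]; apply/le2/le2.
Qed.

Lemma eq_sat p nu mu mu' : {in freeSO p, mu =1 mu'} ->
  sat p nu mu = sat p nu mu'.
Proof.
have eq_update X q (m m' : nat -> cantor_space) w :
    {in [seq Y <- freeSO q | Y != X], m =1 m'} ->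
    {in freeSO q, update m X w =1 update m' X w}.
  move=> mm' Y qY; rewrite /update; case: (eqVneq Y X) => // neYX.
  by rewrite mm' // mem_filter neYX.
elim: p nu mu mu' => //= [x X|p IHp|p IHp q IHq|x p IHp|X p IHp|X p IHp] nu mu mu' eq_mu.
- by rewrite eq_mu ?mem_head.
- by rewrite (IHp _ _ _ eq_mu).
- rewrite (IHp _ mu mu') 1?(IHq _ mu mu') // => Y Yp;
    by apply: eq_mu; rewrite mem_cat Yp ?orbT.
- by apply: eq_forall => k; exact: IHp.
- by apply: eq_forall => w; apply/IHp/eq_update.
- by congr comeager; apply/funext => w; apply/IHp/eq_update.
Qed.

Definition And p q := Neg (Or (Neg p) (Neg q)).
Definition Imp p q := Or (Neg p) q.
Definition ExFO x p := Neg (AllFO x (Neg p)).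
Definition ExSO X p := Neg (AllSO X (Neg p)).

Section Connectives.
Variables (nu : nat -> nat) (mu : nat -> cantor_space).

Lemma sat_Or p q : sat (Or p q) nu mu <-> sat p nu mu \/ sat q nu mu.
Proof. by []. Qed.

Lemma sat_And p q : sat (And p q) nu mu <-> sat p nu mu /\ sat q nu mu.
Proof. by rewrite /= not_orP !notK. Qed.

Lemma sat_Imp p q : sat (Imp p q) nu mu <-> (sat p nu mu -> sat q nu mu).
Proof. by rewrite /= implyE. Qed.

Lemma sat_AllFO x p :
  sat (AllFO x p) nu mu <-> forall k, sat p (update nu x k) mu.
Proof. by []. Qed.

Lemma sat_AllSO X p :
  sat (AllSO X p) nu mu <-> forall w, sat p nu (update mu X w).
Proof. by []. Qed.

Lemma sat_ExFO x p :
  sat (ExFO x p) nu mu <-> exists k, sat p (update nu x k) mu.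
Proof. by rewrite /= -existsNE; split=> -[k]; exists k => //; exact: contrapT. Qed.

Lemma sat_ExSO X p :
  sat (ExSO X p) nu mu <-> exists w, sat p nu (update mu X w).
Proof. by rewrite /= -existsNE; split=> -[k]; exists k => //; exact: contrapT. Qed.

End Connectives.

Definition unbounded_formula P := AllFO 0 (ExFO 1 (And (Less 0 1) (Elem 1 P))).

(** The individual variables 0, 1, 2, 3 play [n], [a], [b], [i] of [matches], and [a <= i] is the
    failure of [Less 3 1]. Fixed numbers are safe because the body in [comeager_with] lies outside
    their scope. *)
Definition matches_formula P Z X :=
  AllFO 0 (ExFO 1 (ExFO 2
    (And (And (And (Less 0 1) (Less 1 2)) (And (Elem 1 P) (Elem 2 P)))
      (AllFO 3 (Imp (Less 3 2) (Or (Less 3 1)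
        (And (Imp (Elem 3 X) (Elem 3 Z)) (Imp (Elem 3 Z) (Elem 3 X))))))))).

Lemma sat_unbounded P nu mu :
  sat (unbounded_formula P) nu mu <-> unbounded (mu P).
Proof.
split=> [/sat_AllFO Pinf n|Pinf].
  by have /sat_ExFO[m /sat_And] := Pinf n; exists m.
apply/sat_AllFO => n; have [m Pm] := Pinf n.
by apply/sat_ExFO; exists m; apply/sat_And.
Qed.

Lemma sat_matches P Z X nu mu :
  sat (matches_formula P Z X) nu mu <-> matches (mu P) (mu Z) (mu X).
Proof.
split=> [/sat_AllFO PZX n|PZX].
  have /sat_ExFO[a /sat_ExFO[b /sat_And[]]] := PZX n.
  move=> /sat_And[/sat_And[lta ltab] /sat_And[Pa Pb]] /sat_AllFO agree.
  exists a, b; split=> //; first exact/andP.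
  move=> i /andP[leai ltib].
  have /sat_Imp/(_ ltib)/sat_Or[|/sat_And[/sat_Imp XZ /sat_Imp ZX]] := agree i.
    by rewrite /= ltnNge leai.
  by apply/idP/idP.
apply/sat_AllFO => n; have [a [b [/andP[lta ltab] Pa Pb XZ]]] := PZX n.
apply/sat_ExFO; exists a; apply/sat_ExFO; exists b; apply/sat_And; split.
  by apply/sat_And; split; apply/sat_And.
apply/sat_AllFO => i; apply/sat_Imp => ltib; apply/sat_Or.
case: (ltnP i a) => leai; [by left|right].
by apply/sat_And; split; apply/sat_Imp; rewrite /= XZ // leai.
Qed.

Definition comeager_with P Z X p :=
  ExSO P (ExSO Z (And (unbounded_formula P)
    (AllSO X (Imp (matches_formula P Z X) p)))).

Lemma sat_comeager_with P Z X p nu mu :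
    uniq [:: P; Z; X] -> P \notin freeSO p -> Z \notin freeSO p ->
  sat (comeager_with P Z X p) nu mu = sat (AllStar X p) nu mu.
Proof.
case/and3P; rewrite !inE negb_or => /andP[nePZ nePX] neZX _ Pp Zp.
have updP V W w : update (update (update mu P V) Z W) X w P = V.
  by rewrite /update (negPf nePX) (negPf nePZ) eqxx.
have updZ V W w : update (update (update mu P V) Z W) X w Z = W.
  by rewrite /update (negPf neZX) eqxx.
have updX V W w : update (update (update mu P V) Z W) X w X = w.
  by rewrite /update eqxx.
have updp V W w : sat p nu (update (update (update mu P V) Z W) X w) =
    sat p nu (update mu X w).
  apply: eq_sat => Y pY; rewrite /update.
  case: eqVneq => // _; case: eqVneq => [eYZ|_]; first by rewrite -eYZ pY in Zp.
  by case: eqVneq => // eYP; rewrite -eYP pY in Pp.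
apply/propext; split.
  move=> /sat_ExSO[V /sat_ExSO[W /sat_And[/sat_unbounded VP /sat_AllSO VWp]]].
  apply: (@matches_comeager _ V W) => [|w Vw].
    by move: VP; rewrite /update eqxx (negPf nePZ).
  change (sat p nu (update mu X w)); rewrite -(updp V W).
  have /sat_Imp := VWp w; apply; apply/sat_matches.
  by rewrite updP updZ updX.
move=> /comeager_matches[V [W [Vinf VWp]]].
apply/sat_ExSO; exists V; apply/sat_ExSO; exists W; apply/sat_And; split.
  by apply/sat_unbounded; rewrite /update eqxx (negPf nePZ).
apply/sat_AllSO => w; apply/sat_Imp => /sat_matches; rewrite updP updZ updX updp.
exact: VWp.
Qed.

Lemma freeSO_comeager_with P Z X p :
  {subset freeSO (comeager_with P Z X p) <= freeSO (AllStar X p)}.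
Proof.
have sub : {subset freeSO (matches_formula P Z X) <= [:: P; Z; X]}.
  by apply/allP; rewrite /= !inE !eqxx !orbT.
(* By computation: the leading [P] comes from [unbounded_formula], and each filter from one set
   quantifier. *)
have -> : freeSO (comeager_with P Z X p) =
    [seq Y <- [seq Y <- P :: [seq Y <- freeSO (matches_formula P Z X) ++ freeSO p
                             | Y != X] | Y != Z] | Y != P] by [].
move=> Y; rewrite !mem_filter in_cons mem_filter mem_cat.
case/and3P=> /negPf neYP /negPf neYZ; rewrite neYP /= => /andP[neYX].
case/orP=> [/sub|->]; last by rewrite neYX.
by rewrite !inE neYP neYZ (negPf neYX).
Qed.

(** The two quantified set variables are fresh: codes bound the set variables
  of a formula. *)
Definition comeager_formula X p :=
  let N := pair_code X (Defs.code p) in comeager_with N.+1 N.+2 X p.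

(** * The translation and its correctness *)

Fixpoint eliminate (phi : formula) : formula :=
  match phi with
  | Less _ _ | Elem _ _ => phi
  | Neg p => Neg (eliminate p)
  | Or p q => Or (eliminate p) (eliminate q)
  | AllFO x p => AllFO x (eliminate p)
  | AllSO X p => AllSO X (eliminate p)
  | AllStar X p => comeager_formula X (eliminate p)
  end.

Lemma isS1S_eliminate phi : isS1S (eliminate phi).
Proof. by elim: phi => //= p -> q ->. Qed.

Lemma sat_comeager_formula X p nu mu :
  sat (comeager_formula X p) nu mu = sat (AllStar X p) nu mu.
Proof.
have leN := leq_pair_code X (Defs.code p).
apply: sat_comeager_with; first by rewrite /= !inE; lia.
  by apply/negP => /freeSO_code; lia.
by apply/negP => /freeSO_code; lia.
Qed.

Lemma sat_eliminate phi nu mu : sat (eliminate phi) nu mu = sat phi nu mu.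
Proof.
elim: phi nu mu => // [p IHp|p IHp q IHq|x p IHp|X p IHp|X p IHp] nu mu.
- by rewrite /= IHp.
- by rewrite /= IHp IHq.
- by apply: eq_forall => k; exact: IHp.
- by apply: eq_forall => w; exact: IHp.
- rewrite sat_comeager_formula /=; congr comeager; apply/funext => w; exact: IHp.
Qed.

Lemma freeFO_eliminate phi : {subset freeFO (eliminate phi) <= freeFO phi}.
Proof.
elim: phi => //= [x y|x X|p IHp q IHq|x p IHp] z //.
  by rewrite !mem_cat => /orP[/IHp->|/IHq->]; rewrite ?orbT.
by rewrite !mem_filter => /andP[-> /IHp].
Qed.

Lemma freeSO_eliminate phi : {subset freeSO (eliminate phi) <= freeSO phi}.
Proof.
elim: phi => //= [x X|p IHp q IHq|X p IHp|X p IHp] Y //; last first.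
- by move=> /freeSO_comeager_with; rewrite !mem_filter => /andP[-> /IHp].
- by rewrite !mem_filter => /andP[-> /IHp].
- by rewrite !mem_cat => /orP[/IHp->|/IHq->]; rewrite ?orbT.
Qed.

Lemma in_context_eliminate m n phi :
  in_context m n phi -> in_context m n (eliminate phi).
Proof.
case/andP=> /allP FO /allP SO; apply/andP; split; apply/allP => v.
  by move=> /freeFO_eliminate/FO.
by move=> /freeSO_eliminate/SO.
Qed.

Lemma language_eliminate m n phi :
  language m n (eliminate phi) = language m n phi.
Proof.
by apply/seteqP; split=> w [nu nuw nuP]; exists nu => //;
  rewrite sat_eliminate in nuP *.
Qed.

(** * Computability of the translation *)

Definition computable n (F : n.-tuple nat -> nat) : Prop :=
  exists f : mu_rec n, forall x, computes f x (F x).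

Definition computable1 (f : nat -> nat) :=
  computable (fun x : 1.-tuple nat => f (thead x)).

Definition computable2 (f : nat -> nat -> nat) :=
  computable (fun x : 2.-tuple nat => f (thead x) (tnth x ord_max)).

Lemma eq_computable n (F G : n.-tuple nat -> nat) :
  F =1 G -> computable F -> computable G.
Proof. by move=> eqFG [f fF]; exists f => x; rewrite -eqFG. Qed.

Lemma computable_tnth n (i : 'I_n) :
  computable (fun x : n.-tuple nat => tnth x i).
Proof. by exists (RProj i). Qed.

Lemma computable_comp k n (F : k.-tuple nat -> nat)
    (G : 'I_k -> n.-tuple nat -> nat) :
  computable F -> (forall j, computable (G j)) ->
  computable (fun x => F [tuple G j x | j < k]).
Proof.
move=> [f fF] /choice[g gG]; exists (RComp f g) => x /=.
by exists [tuple G j x | j < k] => // j; rewrite tnth_mktuple.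
Qed.

Section Closure.
Variable n : nat.
Implicit Types F G H : n.-tuple nat -> nat.

Lemma computable1_comp f G :
  computable1 f -> computable G -> computable (fun x => f (G x)).
Proof.
move=> cf cG; have := @computable_comp 1 n _ (fun=> G) cf (fun=> cG).
by apply: eq_computable => x; rewrite /thead tnth_mktuple.
Qed.

Lemma computable2_comp f F G :
    computable2 f -> computable F -> computable G ->
  computable (fun x => f (F x) (G x)).
Proof.
move=> cf cF cG.
have cFG (j : 'I_2) : computable (if j == ord0 then F else G) by case: ifP.
have := computable_comp cf cFG; apply: eq_computable => x.
by rewrite /thead !tnth_mktuple.
Qed.

Lemma computable_succ F : computable F -> computable (fun x => (F x).+1).
Proof. by apply: computable1_comp; exists RSucc. Qed.

Lemma computable_const k : computable (fun _ : n.-tuple nat => k).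
Proof. by elim: k => [|k IHk]; [exists (RZero n)|exact: computable_succ]. Qed.

End Closure.

Lemma computable_iteri n f (A B : n.-tuple nat -> nat) :
    computable2 f -> computable A -> computable B ->
  computable (fun x => iteri (A x) f (B x)).
Proof.
move=> cf; apply: (@computable2_comp n (fun a b => iteri a f b)).
(* The step program of [RPrec] receives counter, previous value and parameter; the parameter is
   discarded. *)
have [g gf] : computable (fun y : 3.-tuple nat =>
    f (thead y) (tnth y (@Ordinal 3 1 isT))).
  by apply: (computable2_comp cf); apply: computable_tnth.
exists (RPrec (RProj ord0) g) => x /=.
exists (fun i => iteri i f (tnth x ord_max)); split=> //.
by case/tupleP: x => a y; rewrite (tnth_nth 0) [RHS](tnth_nth 0).
Qed.

Lemma computable_min f (v : nat -> nat) : computable2 f ->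
    (forall n, f (v n) n = 0) -> (forall n i, i < v n -> 0 < f i n) ->
  computable1 v.
Proof.
move=> [g gf] fv0 fv; exists (RMin g) => x.
have gE i : computes g [tuple of i :: x] (f i (thead x)).
  rewrite [thead x](tnth_nth 0).
  by have := gf [tuple of i :: x]; rewrite theadE [tnth _ _](tnth_nth 0).
split=> [|i ltiv]; first by have := gE (v (thead x)); rewrite fv0.
by exists (f i (thead x)).-1; rewrite prednK ?fv.
Qed.

Lemma computable_thead n : computable (fun x : n.+1.-tuple nat => thead x).
Proof. exact: computable_tnth. Qed.

(** * Arithmetic and the inversion of Cantor pairing *)

Lemma computable2_addn : computable2 addn.
Proof.
have c : computable2 (fun a b => iteri a (fun _ => succn) b).
  apply: computable_iteri; [|exact: computable_thead|exact: computable_tnth].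
  by apply: computable_succ; exact: computable_tnth.
by apply: eq_computable c => x; elim: (thead x) => //= a ->.
Qed.

Lemma computable1_predn : computable1 predn.
Proof.
(* A step that returns its counter ends with the last counter, the predecessor. *)
have c : computable1 (fun a => iteri a (fun i _ => i) 0).
  by apply: computable_iteri; [exact: computable_thead..|exact: computable_const].
by apply: eq_computable c => x; case: (thead x).
Qed.

Lemma computable2_subn : computable2 subn.
Proof.
have c : computable2 (fun a b => iteri b (fun _ => predn) a).
  apply: computable_iteri; [|exact: computable_tnth|exact: computable_thead].
  by apply: (computable1_comp computable1_predn); exact: computable_tnth.
apply: eq_computable c => x; elim: (tnth x _) => [|b /= ->]; first by rewrite subn0.
by rewrite subnS.
Qed.

(** This repeats the recursion inside [Cantor.to_nat], so [pair_code a b] is convertible to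
    [b + triangular (b + a)]. *)
Definition triangular n := iteri n (fun i m => i.+1 + m) 0.

Lemma computable1_triangular : computable1 triangular.
Proof.
apply: computable_iteri; [|exact: computable_thead|exact: computable_const].
apply: (computable2_comp computable2_addn); last exact: computable_tnth.
by apply: computable_succ; exact: computable_thead.
Qed.

Lemma computable2_pair_code : computable2 pair_code.
Proof.
have add F G := @computable2_comp 2 _ F G computable2_addn.
apply: (add); first exact: computable_tnth.
apply: (computable1_comp computable1_triangular).
by apply: add; exact: computable_tnth.
Qed.

Definition cfst n := (Cantor.of_nat n).1.
Definition csnd n := (Cantor.of_nat n).2.

Lemma cfst_pair a b : cfst (pair_code a b) = a.
Proof. by rewrite /cfst /pair_code Cantor.cancel_of_to. Qed.

Lemma csnd_pair a b : csnd (pair_code a b) = b.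
Proof. by rewrite /csnd /pair_code Cantor.cancel_of_to. Qed.

Lemma pair_cfst_csnd n : pair_code (cfst n) (csnd n) = n.
Proof. by rewrite /pair_code -surjective_pairing Cantor.cancel_to_of. Qed.

Lemma csnd_triangular n : csnd n + triangular (csnd n + cfst n) = n.
Proof. exact: pair_cfst_csnd. Qed.

Lemma leq_triangular m n : m <= n -> triangular m <= triangular n.
Proof.
move=> /subnK<-; elim: (n - m) => // k /leq_trans; apply; exact: leq_addl.
Qed.

(** The diagonal of [n] is the least [w] with [n < triangular w.+1], which minimization finds. Both
    components then follow by subtraction. *)
Lemma computable1_diagonal : computable1 (fun n => csnd n + cfst n).
Proof.
apply: (@computable_min (fun w n => n.+1 - triangular w.+1)).
- have ct := computable1_comp computable1_triangular.
  apply: (computable2_comp computable2_subn).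
    by apply: computable_succ; exact: computable_tnth.
  by apply/ct/computable_succ; exact: computable_thead.
- move=> n; have := csnd_triangular n; rewrite [triangular _.+1]/=; lia.
- move=> n i /leq_triangular; have := csnd_triangular n; lia.
Qed.

Lemma computable1_csnd : computable1 csnd.
Proof.
have c : computable1 (fun n => n - triangular (csnd n + cfst n)).
  apply: (computable2_comp computable2_subn); first exact: computable_thead.
  exact: (computable1_comp computable1_triangular computable1_diagonal).
by apply: eq_computable c => x; have := csnd_triangular (thead x); lia.
Qed.

Lemma computable1_cfst : computable1 cfst.
Proof.
have c : computable1 (fun n => csnd n + cfst n - csnd n).
  exact: (computable2_comp computable2_subn computable1_diagonal computable1_csnd).
by apply: eq_computable c => x; rewrite addKn.
Qed.

(** * Branching and the translation on codes *)

Definition if0 (a b c : nat) := if a is 0 then b else c.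

Section Programs.
Variable n : nat.
Implicit Types F G H : n.-tuple nat -> nat.

Lemma computable_subn F G :
  computable F -> computable G -> computable (fun x => F x - G x).
Proof. exact: (computable2_comp computable2_subn). Qed.

Lemma computable_pair_code F G :
  computable F -> computable G -> computable (fun x => pair_code (F x) (G x)).
Proof. exact: (computable2_comp computable2_pair_code). Qed.

Lemma computable_predn F : computable F -> computable (fun x => (F x).-1).
Proof. exact: (computable1_comp computable1_predn). Qed.

Lemma computable_cfst F : computable F -> computable (fun x => cfst (F x)).
Proof. exact: (computable1_comp computable1_cfst). Qed.

Lemma computable_csnd F : computable F -> computable (fun x => csnd (F x)).
Proof. exact: (computable1_comp computable1_csnd). Qed.

(** If [A] is positive, an iteration of [r |-> (csnd r, csnd r)] from the pair
  [(F, G)] has moved [G] to the first component, where it stays. *)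
Lemma computable_if0 A F G : computable A -> computable F -> computable G ->
  computable (fun x => if0 (A x) (F x) (G x)).
Proof.
move=> cA cF cG; pose shift (_ r : nat) := pair_code (csnd r) (csnd r).
have c : computable (fun x => cfst (iteri (A x) shift (pair_code (F x) (G x)))).
  apply/computable_cfst/computable_iteri => //; last exact: computable_pair_code.
  have c := computable1_comp computable1_csnd (computable_tnth (@ord_max 1)).
  exact: (computable2_comp computable2_pair_code c c).
apply: eq_computable c => x; case: (A x) => [|a] /=; first exact: cfst_pair.
rewrite cfst_pair; elim: a => [|a IHa] /=; first exact: csnd_pair.
by rewrite csnd_pair.
Qed.

End Programs.

Ltac computability :=
  repeat first
    [ exact: computable_const | exact: computable_thead
    | exact: computable_tnth | assumption
    | apply: computable_succ | apply: computable_predn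
    | apply: computable_cfst | apply: computable_csnd
    | apply: computable_pair_code | apply: computable_subn
    | apply: computable_if0 ].

(** Unification would otherwise unfold codes into iterated sums. *)
Opaque pair_code.

(** Mirrors [comeager_with] when the body is known only by its code [c]; on actual formulas the two
    agree by computation. *)
Definition comeager_code P Z X c :=
  let neg := pair_code 2 in
  let disj a b := pair_code 3 (pair_code a b) in
  let all Y a := pair_code 5 (pair_code Y a) in
  let ex Y a := neg (all Y (neg a)) in
  ex P (ex Z (neg (disj (neg (Defs.code (unbounded_formula P)))
    (neg (all X (disj (neg (Defs.code (matches_formula P Z X))) c)))))).

Lemma computable_comeager_code n (P Z X C : n.-tuple nat -> nat) :
  computable P -> computable Z -> computable X -> computable C ->
  computable (fun x => comeager_code (P x) (Z x) (X x) (C x)).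
Proof.
move=> cP cZ cX cC.
rewrite /comeager_code /unbounded_formula /matches_formula.
rewrite /ExFO /And /Imp; cbn [Defs.code].
computability.
Qed.

(** One step of the course-of-values recursion computing
  [code p |-> code (eliminate p)]: [look] returns its values below [c]. *)
Definition eliminate_step (look : nat -> nat) (c : nat) : nat :=
  let t := cfst c in let r := csnd c in
  if0 (t - 1) c
  (if0 (t - 2) (pair_code t (look r))
  (if0 (t - 3) (pair_code t (pair_code (look (cfst r)) (look (csnd r))))
  (if0 (t - 5) (pair_code t (pair_code (cfst r) (look (csnd r))))
    (let X := cfst r in let d := look (csnd r) in
     let N := pair_code X d in comeager_code N.+1 N.+2 X d)))).

(** The history before step [c] is the nested pair
  [(v (c-1), (v (c-2), ... (v 0, 0)))] of the previous values. *)
Definition lookup (c h j : nat) : nat :=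
  cfst (iteri (c.-1 - j) (fun _ => csnd) h).

Definition history (c : nat) : nat :=
  iteri c (fun d h => pair_code (eliminate_step (lookup d h) d) h) 0.

Definition eliminate_code (c : nat) : nat :=
  eliminate_step (lookup c (history c)) c.

Lemma lookup_history c j : j < c -> lookup c (history c) j = eliminate_code j.
Proof.
elim: c => // c IHc; rewrite ltnS leq_eqVlt => /predU1P[->|ltjc].
  by rewrite /lookup subnn /= cfst_pair.
rewrite -IHc // /lookup; case: c ltjc {IHc} => // c; rewrite ltnS => lejc.
rewrite [c.+2.-1]/= subSn //; congr cfst.
(* The longer history needs one more [csnd], which drops its newest entry. [iteri] applies it
   outermost, hence the induction. *)
by elim: (c - j) => [|k /= ->] //; rewrite /= csnd_pair.
Qed.

Lemma computable_eliminate_step n (C H : n.-tuple nat -> nat) :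
  computable C -> computable H ->
  computable (fun x => eliminate_step (lookup (C x) (H x)) (C x)).
Proof.
move=> cC cH.
have look J : computable J -> computable (fun x => lookup (C x) (H x) (J x)).
  move=> cJ; apply: computable_cfst; apply: computable_iteri => //.
    by apply: computable_csnd; exact: computable_tnth.
  by computability.
have t k : computable (fun x => cfst (C x) - k) by computability.
have ct := computable_cfst cC; have cr := computable_csnd cC.
have [cr1 cr2] := (computable_cfst cr, computable_csnd cr).
have pair F G := @computable_pair_code n F G.
apply: computable_if0 (t 1) cC _.
apply: computable_if0 (t 2) (pair _ _ ct (look _ cr)) _.
apply: computable_if0 (t 3) (pair _ _ ct (pair _ _ (look _ cr1) (look _ cr2))) _.
apply: computable_if0 (t 5) (pair _ _ ct (pair _ _ cr1 (look _ cr2))) _.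
have cN := computable_succ (pair _ _ cr1 (look _ cr2)).
exact: computable_comeager_code cN (computable_succ cN) cr1 (look _ cr2).
Qed.

Lemma computable1_eliminate_code : computable1 eliminate_code.
Proof.
apply: computable_eliminate_step; first exact: computable_thead.
apply: computable_iteri; [|exact: computable_thead|exact: computable_const].
apply: computable_pair_code; last exact: computable_tnth.
by apply: computable_eliminate_step; exact: computable_tnth.
Qed.

(** Compound formulas have positive tags, so the codes of their immediate subformulas are strictly
    smaller and every lookup returns the intended value. *)
Lemma eliminate_codeE p : eliminate_code (Defs.code p) = Defs.code (eliminate p).
Proof.
have lookE c r : r < c -> lookup c (history c) r = eliminate_code r.
  exact: lookup_history.
have ltr a b c : b <= c -> b < pair_code a.+1 c.
  by move=> lebc; exact: leq_ltn_trans (ltn_pair_code a c).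
have le1 a b : a <= pair_code a b by have := leq_pair_code a b; lia.
have le2 a b : b <= pair_code a b by have := leq_pair_code a b; lia.
elim: p => [x y|x X|p IHp|p IHp q IHq|x p IHp|X p IHp|X p IHp] //=.
(* Truncated subtraction from the tag selects the branch: 0 and 1 are the atoms, 2 is [Neg], 3 is
   [Or], 4 and 5 share the branch of the ordinary quantifiers, and 6 is [AllStar]. *)
1-2: by rewrite /eliminate_code /eliminate_step cfst_pair.
all: rewrite {1}/eliminate_code /eliminate_step ?(cfst_pair, csnd_pair) /=.
all: by rewrite !lookE ?IHp ?IHq ?ltn_pair_code ?ltr ?le1 ?le2.
Qed.

Lemma effective_eliminate : effective eliminate.
Proof.
have [f fE] := computable1_eliminate_code.
by exists f => p; rewrite -eliminate_codeE; have := fE [tuple Defs.code p].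
Qed.

Theorem theorem4p1 :
  exists2 tr : formula -> formula, effective tr &
    forall phi : formula,
      isS1S (tr phi) /\
      forall m n : nat, in_context m n phi ->
        in_context m n (tr phi) /\
        language m n (tr phi) = language m n phi.
Proof.
exists eliminate; first exact: effective_eliminate.
move=> phi; split=> [|m n phimn]; first exact: isS1S_eliminate.
by split; [exact: in_context_eliminate|exact: language_eliminate].
Qed.
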